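(* Let $N\ge 2$. There exists a seminorm $\|\cdot\|_{\rm Kur}$ on the vector space $\mathbb{R}^N_0$ such that $$\mathcal{D}_N=\{\omega\in\mathbb{R}^N_0:\ \|\omega\|_{\rm Kur}<1\}.$$
   Context: $\mathbb{R}^N_0=\{x\in\mathbb{R}^N:\sum_{i=1}^N x_i=0\}$. For $\omega\in\mathbb{R}^N_0$ consider the Kuramoto system $\frac{d\theta_i}{dt}=\omega_i+\sum_{j=1}^N\sin(\theta_j-\theta_i)$, $i=1,\dots,N$. A fixed point $\theta$ of this system is called stable if it is orbitally (linearly) stable modulo the rotational invariance $\theta\mapsto\theta+c(1,\dots,1)^t$, i.e. the Jacobian of the vector field at $\theta$ (a symmetric matrix) has a simple zero eigenvalue, with eigenvector $(1,\dots,1)^t$, and $N-1$ strictly negative eigenvalues. The stable phase-locked region is $\mathcal{D}_N=\{\omega\in\mathbb{R}^N_0:\text{ the system has a stable fixed point}\}$. *)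

(* Defs.v *)
From HB Require Import structures.
From mathcomp Require Import all_boot all_order all_algebra.
From mathcomp Require Import all_classical all_reals all_analysis.
Import Order.TTheory GRing.Theory Num.Theory.
Import numFieldNormedType.Exports.

Set Implicit Arguments.
Unset Strict Implicit.
Unset Printing Implicit Defensive.

Local Open Scope classical_set_scope.
Local Open Scope ring_scope.

Record is_seminorm (R : realType) (V : lmodType R) (p : V -> R) : Prop :=
  IsSeminorm {
    seminorm_ge0 : forall x, 0 <= p x;
    seminormZ : forall a x, p (a *: x) = `|a| * p x;
    seminormD : forall x y, p (x + y) <= p x + p y }.

Section ZeroSum.
Variables (R : realType) (N : nat).

Definition coord_sum (x : 'rV[R]_N) : R^o := \sum_i x ord0 i.

Fact coord_sum_is_linear : linear coord_sum.
Proof.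
move=> a x y; rewrite /coord_sum scaler_sumr -big_split /=.
by apply: eq_bigr => i _; rewrite !mxE.
Qed.

HB.instance Definition _ :=
  GRing.isLinear.Build R 'rV[R]_N R^o _ coord_sum coord_sum_is_linear.

Definition zero_sum : {vspace 'rV[R]_N} := lker (linfun coord_sum).

Lemma mem_zero_sum (x : 'rV[R]_N) :
  (x \in zero_sum) = (\sum_i x ord0 i == 0).
Proof. by rewrite memv_ker lfunE. Qed.

End ZeroSum.

Definition kuramoto (R : realType) (N : nat) (omega theta : 'rV[R]_N)
    : 'rV[R]_N :=
  \row_i (omega ord0 i + \sum_j sin (theta ord0 j - theta ord0 i)).

(* The library's Jacobian acts on row vectors: v *m jacobian f theta is the
   derivative of f at theta in the direction v.  The factorization of the
   characteristic polynomial lists the eigenvalues with multiplicity: a simple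
   eigenvalue 0 and N - 1 negative ones. *)
Definition stable_fixed_point (R : realType) (N : nat)
    (f : 'rV[R]_N -> 'rV[R]_N) (theta : 'rV[R]_N) : Prop :=
  [/\ f theta = 0,
      (const_mx 1 : 'rV[R]_N) *m jacobian f theta = 0
    & exists2 s : N.-1.-tuple R, all (fun l => l < 0) s &
        char_poly (jacobian f theta) = 'X * \prod_(l <- s) ('X - l%:P)].

Definition stable_region (R : realType) (N : nat)
    : set (subvs_of (zero_sum R N)) :=
  [set omega | exists theta : 'rV[R]_N,
     stable_fixed_point (kuramoto (vsval omega)) theta].

Arguments stable_region : clear implicits.

(* Main.v *)
(* In the frame of the mean phase a fixed point satisfies omega_i = r s_i with
   c_i^2 + s_i^2 = 1, sum c_i = r and sum s_i = 0, and its Jacobian is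
   c c^T + s s^T - r diag(c).  This form is negative off the constants iff all
   c_i > 0 and sum s_i^2 / c_i < r.  With u = r^2 the fixed point equation reads
   u = sum_i sqrt (u - omega_i^2), whose right-hand side is concave in u, and
   stability says that this right-hand side has derivative < 1 at u.  By
   concavity, omega is in the stable region iff
   r^2 < sum_i sqrt (r^2 - omega_i^2) for some r >= max |omega_i|.  Hence the
   stable region is the open unit ball of
     inf_r r^2 / sum_i sqrt (r^2 - omega_i^2),
   which is homogeneous, and subadditive because sqrt (r^2 - omega_i^2) is
   superadditive in (r, omega_i) and (r, S) |-> r^2 / S is subadditive. *)

Require Import Defs.
From mathcomp Require Import all_boot all_order all_algebra.
From mathcomp Require Import all_classical all_reals all_analysis.
From mathcomp Require Import spectral complex ring lra.
Import Order.TTheory GRing.Theory Num.Theory.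
Import numFieldNormedType.Exports.

Set Implicit Arguments.
Unset Strict Implicit.
Unset Printing Implicit Defensive.

Local Open Scope classical_set_scope.
Local Open Scope ring_scope.

(** * Real symmetric matrices with a given kernel vector *)

Lemma char_poly_conj (F : fieldType) n (P A : 'M[F]_n) :
  P \in unitmx -> char_poly (invmx P *m A *m P) = char_poly A.
Proof.
move=> Pu; rewrite /char_poly; have -> : char_poly_mx (invmx P *m A *m P) =
    map_mx polyC (invmx P) *m char_poly_mx A *m map_mx polyC P.
  rewrite /char_poly_mx mulmxBr mulmxBl !map_mxM; congr (_ - _).
  rewrite mul_mx_scalar -scalemxAl -map_mxM mulVmx //.
  by rewrite map_mx1 scalemx1.
rewrite !det_mulmx mulrAC -det_mulmx -map_mxM.
by rewrite mulVmx // map_mx1 det1 mul1r.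
Qed.

(** Over [R[i]] the matrix is Hermitian, hence unitarily diagonalizable with real eigenvalues, so
    the factorization of its characteristic polynomial descends to [R]. *)
Lemma symmetric_spectral (R : rcfType) n (A : 'M[R]_n) : A^T = A ->
  exists (U : 'M[R[i]]_n) (d : 'I_n -> R),
    [/\ U \is unitarymx,
      map_mx (real_complex R) A =
        invmx U *m diag_mx (\row_i real_complex R (d i)) *m U
    & char_poly A = \prod_i ('X - (d i)%:P)].
Proof.
move=> Asym; set AC := map_mx (real_complex R) A.
have ACh : AC \is hermsymmx.
  apply/is_hermitianmxP; rewrite expr0 scale1r /AC.
  apply/matrixP => i j; rewrite !mxE.
  have -> : A j i = A i j by rewrite -{1}Asym mxE.
  by rewrite conj_Creal // complex_real.
pose U := spectralmx AC; pose d i := complex.Re (spectral_diag AC 0 i).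
have dE : spectral_diag AC = \row_i real_complex R (d i).
  apply/rowP => i; rewrite mxE RRe_real //.
  by have /mxOverP := hermitian_spectral_diag_real ACh; apply.
have ACE : AC = invmx U *m diag_mx (\row_i real_complex R (d i)) *m U.
  by rewrite -dE; apply/orthomx_spectralP/hermitian_normalmx.
exists U, d; split => //; first exact: spectral_unitarymx.
apply: (map_poly_inj (real_complex R)).
rewrite map_char_poly -/AC ACE char_poly_conj ?spectral_unit //.
rewrite char_poly_trig ?diag_mx_is_trig // rmorph_prod.
apply: eq_bigr => i _.
by rewrite rmorphB /= map_polyX map_polyC /= !mxE eqxx mulr1n.
Qed.

Lemma symmetric_spectral_form (R : rcfType) n (A : 'M[R]_n)
    (U : 'M[R[i]]_n) (d : 'I_n -> R) (x : 'rV[R]_n) :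
  U \is unitarymx ->
  map_mx (real_complex R) A =
    invmx U *m diag_mx (\row_i real_complex R (d i)) *m U ->
  let y := map_mx (real_complex R) x *m invmx U in
  (x *m A *m x^T) 0 0 =
    \sum_i d i * (complex.Re (y 0 i) ^+ 2 + complex.Im (y 0 i) ^+ 2).
Proof.
move=> Uu AE y; apply: (@complexI R).
transitivity (map_mx (real_complex R) (x *m A *m x^T) 0 0).
  by rewrite [RHS]mxE.
rewrite !map_mxM AE !mulmxA -/y rmorph_sum /= -mulmxA.
have -> : U *m map_mx (real_complex R) x^T = map_mx Num.conj y^T.
  rewrite /y invmx_unitary // trmx_mul map_mxM map_trmx trmxK.
  rewrite -map_mx_comp (map_mx_id (@conjCK _)); congr (_ *m _).
  by apply/colP => i; rewrite !mxE; apply/esym/CrealP; rewrite complex_real.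
rewrite mul_mx_diag mxE; apply: eq_bigr => i _.
by rewrite !mxE rmorphM /= add_Re2_Im2 normCK mulrAC mulrC.
Qed.

(** Turns the eigenvalue condition of stability into a sign condition on the quadratic form. In
    eigencoordinates the form is [\sum_i d i * |y_i|^2], and [u] accounts for one zero eigenvalue,
    at [i0]. *)
Lemma symmetric_char_poly_simple_kernel (R : rcfType) n (A : 'M[R]_n)
    (u : 'rV_n) : A^T = A -> u != 0 -> u *m A = 0 ->
  (exists2 s : n.-1.-tuple R, all (fun l => l < 0) s &
     char_poly A = 'X * \prod_(l <- s) ('X - l%:P)) <->
  (forall x : 'rV_n, ~~ (x <= u)%MS -> (x *m A *m x^T) 0 0 < 0).
Proof.
move=> Asym u0 uA; have [U [d [Uu AE chE]]] := symmetric_spectral Asym.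
have Uunit := unitarymx_unit Uu.
pose toC := real_complex R.
pose y (x : 'rV[R]_n) := map_mx toC x *m invmx U.
have formE x : (x *m A *m x^T) 0 0 =
    \sum_i d i * (complex.Re (y x 0 i) ^+ 2 + complex.Im (y x 0 i) ^+ 2).
  exact: symmetric_spectral_form.
have sq0 (z : R[i]) : complex.Re z ^+ 2 + complex.Im z ^+ 2 = 0 -> z = 0.
  move=> /eqP; rewrite paddr_eq0 ?sqr_ge0 // !sqrf_eq0.
  by case: z => a b /= /andP[/eqP-> /eqP->].
have yK x : y x *m U = map_mx toC x by rewrite mulmxKV.
have [i0 di0 yi0] : exists2 i0, d i0 = 0 & y u 0 i0 != 0.
  have yu0 : y u != 0.
    apply: contra u0 => /eqP yu0; have := yK u; rewrite yu0 mul0mx.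
    by move=> /esym/eqP; rewrite map_mx_eq0.
  have [i yi] : exists i, y u 0 i != 0 by apply/rV0Pn.
  exists i => //; have : y u *m diag_mx (\row_i toC (d i)) = 0.
    apply: (can_inj (mulmxK Uunit)); rewrite mul0mx /y -!mulmxA.
    by rewrite (mulmxA (invmx U)) -AE -map_mxM uA map_mx0.
  move: (y u) yi => v vi /rowP/(_ i)/eqP.
  by rewrite mul_mx_diag !mxE mulf_eq0 (negPf vi) /= fmorph_eq0 => /eqP.
split=> [[s sneg sE] x xu | neg].
  have ps : perm_eq [seq d i | i <- enum 'I_n] (0 :: s).
    apply: prod_XsubC_eq; rewrite big_cons subr0 -sE chE big_map.
    by rewrite big_enum.
  (* Removing one zero from both lists of roots leaves exactly [s]. *)
  have dneg i : i != i0 -> d i < 0.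
    move=> ii0; have iin : i \in rem i0 (enum 'I_n).
      by rewrite mem_rem_uniq ?enum_uniq // !inE ii0 mem_enum.
    have : perm_eq [seq d i | i <- rem i0 (enum 'I_n)] s.
      rewrite -(perm_cons 0) -{1}di0; apply: perm_trans ps.
      by rewrite -map_cons perm_map // perm_sym perm_to_rem ?mem_enum.
    move=> /perm_mem ps'; apply: (allP sneg); rewrite -ps'.
    exact: map_f.
  have dle i : d i <= 0.
    by case: (eqVneq i i0) => [->|/dneg/ltW //]; rewrite di0.
  have termN z i :
      0 <= - (d i * (complex.Re (y z 0 i) ^+ 2 + complex.Im (y z 0 i) ^+ 2)).
    by rewrite oppr_ge0 mulr_le0_ge0 // addr_ge0 ?sqr_ge0.
  have form0 z : (z *m A *m z^T) 0 0 = 0 -> forall i, i != i0 -> y z 0 i = 0.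
    rewrite formE => /eqP; rewrite -oppr_eq0 -sumrN psumr_eq0 //.
    move=> /allP z0 i ii0; have := z0 i (mem_index_enum i).
    by rewrite oppr_eq0 mulf_eq0 lt_eqF ?dneg //= => /eqP/sq0.
  rewrite lt_neqAle -oppr_ge0 {2}formE -sumrN sumr_ge0 ?andbT //.
  apply: contra xu => /eqP/form0 yx0.
  have /form0 yu0 : (u *m A *m u^T) 0 0 = 0 by rewrite uA mul0mx mxE.
  (* Both [x] and [u] vanish in every eigencoordinate but [i0], so they are proportional over
     [R[i]], and the inclusion descends to [R]. *)
  rewrite -(map_submx toC) -!yK; apply/submxMr/sub_rVP.
  move: (y x) (y u) yx0 yu0 yi0 => v w v0 w0 wi0.
  exists (v 0 i0 / w 0 i0); apply/rowP => i; rewrite [RHS]mxE.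
  case: (eqVneq i i0) => [->|ii0]; first by rewrite divfK.
  by rewrite (v0 i) // (w0 i) // mulr0.
have rowAE i : row i U *m map_mx toC A = toC (d i) *: row i U.
  rewrite AE !mulmxA -row_mul mulmxV // row1 -rowE row_diag_mx mxE.
  by rewrite -scalemxAl -rowE.
have eig_sub (a : 'rV[R]_n) i : 0 <= d i -> a *m A = d i *: a -> (a <= u)%MS.
  move=> di aE; apply: contraT => /neg; rewrite aE -scalemxAl mxE.
  rewrite ltNge mulr_ge0 // mxE sumr_ge0 // => k _.
  by rewrite mxE -expr2 sqr_ge0.
have rowu i : 0 <= d i -> (row i U <= map_mx toC u)%MS.
  (* As [A] and [d i] are real, the real and imaginary parts of the row satisfy the same eigenvector
     equation over [R]. *)
  move=> di; pose re := map_mx (@complex.Re R) (row i U).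
  pose im := map_mx (@complex.Im R) (row i U).
  have rowC : row i U = map_mx toC re + 'i%C *: map_mx toC im.
    by apply/rowP => k; rewrite !mxE -complexE.
  have [reE imE] : re *m A = d i *: re /\ im *m A = d i *: im.
    have := rowAE i; rewrite {1}rowC mulmxDl -scalemxAl -!map_mxM => /rowP e.
    split; apply/rowP => k; have := e k; rewrite !mxE /=;
      case: (U i k) => a b /eqP; rewrite eq_complex /=;
      rewrite !(mul0r, mulr0, mul1r, subr0, add0r, addr0);
      by move=> /andP[/eqP eR /eqP eI]; rewrite ?eR ?eI.
  rewrite rowC addmx_sub ?scalemx_sub // map_submx; first exact: eig_sub reE.
  exact: eig_sub imE.
(* A second nonnegative eigenvalue would put two rows of the invertible [U] on one line. *)
have dneg i : i != i0 -> d i < 0.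
  move=> ii0; rewrite ltNge; apply/negP => /rowu /sub_rVP[a rowi].
  have /sub_rVP[b rowi0] : (row i0 U <= map_mx toC u)%MS.
    by apply: rowu; rewrite di0.
  have e : b *: row i U = a *: row i0 U by rewrite rowi rowi0 !scalerA mulrC.
  have {e} : b *: delta_mx 0 i = a *: delta_mx 0 i0 :> 'rV[R[i]]_n.
    by apply: (can_inj (mulmxK Uunit)); rewrite -!scalemxAl -!rowE.
  move=> /rowP/(_ i); rewrite !mxE !eqxx (negPf ii0) mulr0 mulr1 => b0.
  move: rowi0; rewrite b0 scale0r => /(congr1 (mulmx^~ (invmx U))).
  rewrite mul0mx rowE mulmxK // => /rowP/(_ i0); rewrite !mxE !eqxx.
  by move=> /eqP; rewrite oner_eq0.
have szs : size [seq d i | i <- enum (predC1 i0)] == n.-1.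
  by rewrite size_map -cardE cardC1 card_ord.
exists (Tuple szs).
  by rewrite /= all_map; apply/allP => i; rewrite mem_enum => /dneg.
rewrite chE (bigD1 i0) //= di0 subr0 big_map; congr (_ * _).
by rewrite big_enum.
Qed.

(** * The Jacobian of the Kuramoto field *)

Lemma differentiable_rV (R : realType) (V : normedModType R) n
    (f : V -> 'rV[R]_n) (x : V) :
  (forall i, differentiable (fun y => f y ord0 i) x) -> differentiable f x.
Proof.
move=> df.
have -> : f =
    \sum_(i < n) (fun y => f y ord0 i *: (delta_mx ord0 i : 'rV[R]_n)).
  by apply/funext => y; rewrite fct_sumE {1}(row_sum_delta (f y)).
by apply: differentiable_sum => i; apply: differentiableZl.
Qed.

Lemma is_derive_coord (R : realType) m n (M v : 'M[R]_(m, n)) i j :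
  is_derive M v (fun N : 'M[R]_(m, n) => N i j : R) (v i j).
Proof.
apply: DeriveDef; first exact/diff_derivable/differentiable_coord.
by rewrite -[in RHS](@derive_id _ _ M v) derive_mx ?mxE.
Qed.

Lemma differentiable_sin_sub (R : realType) n (theta : 'rV[R]_n) (i j : 'I_n) :
  differentiable (fun t : 'rV[R]_n => sin (t ord0 j - t ord0 i)) theta.
Proof.
apply: (@differentiable_comp _ _ _ _ (fun t : 'rV[R]_n => t ord0 j - t ord0 i)).
  by apply: differentiableB; exact: differentiable_coord.
exact/derivable1_diffP/derivable_sin.
Qed.

Lemma is_derive_sin_sub (R : realType) n (theta v : 'rV[R]_n) (i j : 'I_n) :
  is_derive theta v (fun t : 'rV[R]_n => sin (t ord0 j - t ord0 i))
    (cos (theta ord0 j - theta ord0 i) * (v ord0 j - v ord0 i)).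
Proof.
pose l (t : 'rV[R]_n) : R := t ord0 j - t ord0 i.
have dl : is_derive theta v l (v ord0 j - v ord0 i).
  by apply: is_deriveB; exact: is_derive_coord.
have diff_l : differentiable l theta.
  by apply: differentiableB; exact: differentiable_coord.
have ds : differentiable (sin : R -> R) (l theta).
  exact/derivable1_diffP/derivable_sin.
apply: DeriveDef; first exact/diff_derivable/differentiable_sin_sub.
rewrite -[X in 'D_v X _]/(sin \o l) deriveE; last exact: differentiable_comp.
rewrite diff_comp //= diff1E // derive1E derive_val -deriveE // derive_val.
exact: mulrC.
Qed.

(** The diagonal sum runs over all [k]: its term [k = i] is 1 and cancels the leading [cos 0]. *)
Lemma jacobian_kuramoto (R : realType) n (omega theta : 'rV[R]_n) :
  jacobian (kuramoto omega) theta =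
  \matrix_(i, j) (cos (theta ord0 i - theta ord0 j) -
     (\sum_k cos (theta ord0 k - theta ord0 i)) *+ (i == j)).
Proof.
set J := RHS.
have fE k : (fun t => kuramoto omega t ord0 k) =
   cst (omega ord0 k) + \sum_j (fun t : 'rV[R]_n => sin (t ord0 j - t ord0 k)).
  by apply/funext => t; rewrite mxE /= fctE fct_sumE.
have df : differentiable (kuramoto omega) theta.
  apply: differentiable_rV => k; rewrite fE.
  apply: differentiableD; first exact: differentiable_cst.
  by apply: differentiable_sum => j; exact: differentiable_sin_sub.
apply/row_matrixP => i; rewrite !rowE -deriveEjacobian //.
rewrite derive_mx; last exact: diff_derivable.
apply/rowP => k; rewrite mxE fE -rowE mxE.
have dsin j := is_derive_sin_sub theta (delta_mx 0 i) k j.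
rewrite derive_val add0r !mxE.
under eq_bigr => j _ do rewrite mxE eqxx /= mulrBr.
rewrite sumrB (bigD1 i) //= eqxx mulr1.
rewrite big1 ?addr0 => [|j /negPf ->]; last by rewrite mulr0.
rewrite -mulr_suml eq_sym; congr (_ - _).
by case: eqP => [->|_]; rewrite ?mulr1 ?mulr0.
Qed.

(** * The Jacobian in the frame of the mean phase *)

Definition locked_mx (R : realType) n (r : R) (c s : 'I_n -> R) : 'M[R]_n :=
  \matrix_(i, j) (c i * c j + s i * s j - (r * c i) *+ (i == j)).

Lemma locked_mx_form (R : realType) n (r : R) (c s : 'I_n -> R) (x : 'rV[R]_n) :
  (x *m locked_mx r c s *m x^T) 0 0 =
  (\sum_i c i * x 0 i) ^+ 2 + (\sum_i s i * x 0 i) ^+ 2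
  - r * \sum_i c i * x 0 i ^+ 2.
Proof.
have sumM (a : 'I_n -> R) j :
    \sum_i x 0 i * (a i * a j) = (\sum_i a i * x 0 i) * a j.
  by rewrite mulr_suml; apply: eq_bigr => i _; ring.
rewrite mxE; under eq_bigr => j _.
  rewrite !mxE.
  under eq_bigr => i _ do rewrite !mxE mulrBr mulrDr.
  rewrite sumrB big_split /= [X in _ - X](bigD1 j) //= eqxx mulr1n.
  rewrite [X in _ - (_ + X)]big1 ?addr0; last first.
    by move=> i /negPf ->; rewrite mulr0n mulr0.
  rewrite mulrBl mulrDl.
  rewrite !sumM -!mulrA; over.
rewrite sumrB big_split /= -!mulr_sumr -!expr2; congr (_ - _).
by rewrite mulr_sumr; apply: eq_bigr => i _; ring.
Qed.

(** Centering [x] at its [c]-weighted mean [m] turns the form into [B ^+ 2 - r * V]. Cauchy-Schwarz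
    gives [B ^+ 2 <= V * T], and [T < r]. *)
Lemma locked_form_lt0 (R : realType) n (r : R) (c s : 'I_n -> R)
    (x : 'rV[R]_n) :
  (forall i, 0 < c i) -> \sum_i c i = r -> \sum_i s i = 0 ->
  \sum_i s i ^+ 2 / c i < r -> ~~ (x <= (const_mx 1 : 'rV[R]_n))%MS ->
  (x *m locked_mx r c s *m x^T) 0 0 < 0.
Proof.
move=> c0 cr s0 Tr xconst; rewrite locked_mx_form.
set T := \sum_i _ in Tr.
have T0 : 0 <= T by apply: sumr_ge0 => i _; rewrite divr_ge0 ?sqr_ge0 // ltW.
have r0 : 0 < r by apply: le_lt_trans Tr.
pose m := (\sum_i c i * x 0 i) / r.
pose V := \sum_i c i * (x 0 i - m) ^+ 2; pose B := \sum_i s i * (x 0 i - m).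
have V0 : 0 < V.
  rewrite lt_neqAle eq_sym sumr_ge0 ?andbT; last first.
    by move=> i _; rewrite mulr_ge0 ?sqr_ge0 // ltW.
  apply: contra xconst; rewrite psumr_eq0; last first.
    by move=> i _; rewrite mulr_ge0 ?sqr_ge0 // ltW.
  move=> /allP xm; apply/sub_rVP; exists m; apply/rowP => i; rewrite !mxE mulr1.
  have := xm i (mem_index_enum i).
  by rewrite mulf_eq0 gt_eqF //= sqrf_eq0 subr_eq0 => /eqP.
have BE : \sum_i s i * x 0 i = B.
  rewrite /B; under [RHS]eq_bigr => i _ do rewrite mulrBr.
  by rewrite sumrB -mulr_suml s0 mul0r subr0.
have VE : r * \sum_i c i * x 0 i ^+ 2 = r * V + (\sum_i c i * x 0 i) ^+ 2.
  have -> : V =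
      \sum_i c i * x 0 i ^+ 2 - m *+ 2 * (\sum_i c i * x 0 i) + m ^+ 2 * r.
    rewrite -cr !mulr_sumr -sumrB -big_split /=; apply: eq_bigr => i _; ring.
  by rewrite /m; field; rewrite gt_eqF.
(* The multiplier [B / r] stands in for the optimal [B / T], since [T] may vanish. *)
have CS : 0 <= V - 2 * (B / r) * B + (B / r) ^+ 2 * T.
  have -> : V - 2 * (B / r) * B + (B / r) ^+ 2 * T =
      \sum_i c i * ((x 0 i - m) - (B / r) * (s i / c i)) ^+ 2.
    rewrite {2}/B !mulr_sumr -sumrB -big_split /=; apply: eq_bigr => i _.
    by field; rewrite !gt_eqF.
  by apply: sumr_ge0 => i _; rewrite mulr_ge0 ?sqr_ge0 // ltW.
rewrite BE VE; suff : B ^+ 2 < r * V by lra.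
have [B0|B0] := eqVneq B 0; first by rewrite B0 expr0n mulr_gt0.
have b0 : 0 < (B / r) ^+ 2.
  by rewrite exprn_even_gt0 //= mulf_eq0 invr_eq0 (negPf B0) gt_eqF.
have BE' : B = (B / r) * r by rewrite divfK ?gt_eqF.
move: CS b0; rewrite BE' mulfK ?gt_eqF //; move: (B / r) => b CS b0.
have : 0 < r * (b ^+ 2 * (r - T)) by rewrite mulr_gt0 // mulr_gt0 // subr_gt0.
have : 0 <= r * (V - 2 * b * (b * r) + b ^+ 2 * T) by rewrite mulr_ge0 // ltW.
nra.
Qed.

(** The basis vectors, nonconstant because [1 < n], give [1 < r * c i]; the vector [s / c] then
    gives the last bound. *)
Lemma locked_form_lt0_inv (R : realType) n (r : R) (c s : 'I_n -> R) :
  (1 < n)%N -> (forall i, c i ^+ 2 + s i ^+ 2 = 1) ->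
  0 <= r -> \sum_i c i = r -> \sum_i s i = 0 ->
  (forall x : 'rV[R]_n, ~~ (x <= (const_mx 1 : 'rV[R]_n))%MS ->
     (x *m locked_mx r c s *m x^T) 0 0 < 0) ->
  [/\ 0 < r, forall i, 1 < r * c i & \sum_i s i ^+ 2 / c i < r].
Proof.
move=> n1 cs1 r_ge0 cr s0 neg.
have diag i : 1 < r * c i.
  have e0 : ~~ ((delta_mx 0 i : 'rV[R]_n) <= (const_mx 1 : 'rV[R]_n))%MS.
    apply/negP => /sub_rVP[a /rowP e].
    have [k ki] : exists k : 'I_n, k != i.
      exists (if i == Ordinal (ltnW n1) then Ordinal n1 else Ordinal (ltnW n1)).
      by have [->|] := eqVneq i (Ordinal (ltnW n1)); rewrite // eq_sym.
    have := e i; have := e k; rewrite !mxE !eqxx (negPf ki) /= mulr1 => <-.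
    by move=> /eqP; rewrite oner_eq0.
  have := neg _ e0; rewrite -rowE mxE (bigD1 i) //=.
  rewrite big1 => [|k /negPf ki]; last first.
    by rewrite !mxE ki andbF mulr0.
  rewrite !mxE !eqxx mulr1n mulr1 addr0 -!expr2 cs1; lra.
have r0 : 0 < r.
  rewrite lt_neqAle r_ge0 andbT eq_sym; apply/eqP => r0.
  by have := diag (Ordinal n1); rewrite r0 mul0r ltr10.
split => //.
have c0 i : 0 < c i.
  by have := diag i; rewrite -(pmulr_rgt0 _ r0); apply: lt_trans.
set T := \sum_i _.
(* On the test vector [s / c] the form is [T ^+ 2 - r * T]. *)
have [/sub_rVP[a /rowP xa]|/neg] :=
    boolP ((\row_i (s i / c i) : 'rV[R]_n) <= (const_mx 1 : 'rV[R]_n))%MS.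
  have sE i : s i = a * c i.
    by have := xa i; rewrite !mxE mulr1 => <-; rewrite divfK // gt_eqF.
  have a0 : a = 0.
    move: s0; under eq_bigr => i _ do rewrite sE.
    by rewrite -mulr_sumr cr => /eqP; rewrite mulf_eq0 (gt_eqF r0) orbF => /eqP.
  by rewrite /T big1 // => i _; rewrite sE a0 mul0r expr0n mul0r.
rewrite locked_mx_form.
under eq_bigr => i _ do rewrite mxE mulrC divfK ?gt_eqF //.
rewrite s0 expr0n add0r.
rewrite (_ : \sum_i s i * _ = T); last first.
  by apply: eq_bigr => i _; rewrite mxE mulrA expr2.
rewrite (_ : \sum_i c i * _ = T); last first.
  by apply: eq_bigr => i _; rewrite mxE; field; rewrite gt_eqF.
have T0 : 0 <= T by apply: sumr_ge0 => i _; rewrite divr_ge0 ?sqr_ge0 // ltW.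
nra.
Qed.

(** * The fixed point equation *)

(** For [|w_i| <= sqrt u], each term is half the chord at distance [|w_i|] from the center of a
    circle of radius [sqrt u]. *)
Definition chord_sum (R : realType) n (w : 'rV[R]_n) (u : R) : R :=
  \sum_i Num.sqrt (u - w 0 i ^+ 2).

(** The numbers strictly above [r^2 / S] for some admissible [r], with the division cleared so that
    [S = 0] contributes none. *)
Definition kur_levels (R : realType) n (w : 'rV[R]_n) : set R :=
  [set q | exists r, [/\ 0 < r, forall i, `|w 0 i| <= r
                      & r ^+ 2 < q * chord_sum w (r ^+ 2)]].

Lemma sqrt_sub_ge (R : realType) (a d : R) : 1 <= a -> 0 <= d <= 1 ->
  a - d / (2 * a) - d ^+ 2 / 2 <= Num.sqrt (a ^+ 2 - d).
Proof.
move=> a1 /andP[d0 d1]; have a0 : 0 < a by lra.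
(* Since [b <= |b|], comparing squares suffices, whatever the sign of [b]. *)
have da : d / a <= a by rewrite ler_pdivrMr //; nra.
set b := _ - _ - _; apply: le_trans (ler_norm b) _.
rewrite -sqrtr_sqr ler_wsqrtr // /b.
have -> : d / (2 * a) = (d / a) / 2 by field; lra.
have dE : d = (d / a) * a by rewrite divfK; lra.
have : 0 <= d / a by rewrite divr_ge0 // ltW.
move: (d / a) dE da => t dE ta t0.
rewrite dE in d1 d0 *.
have t1 : t <= 1 by nra.
have tp : t <= t * a by rewrite ler_peMr.
move tpE : (t * a) d0 d1 tp => p p0 p1 tp.
have t2 : t ^+ 2 <= p ^+ 2 by rewrite lerXn2r.
have p2 : 0 <= p ^+ 2 by apply: sqr_ge0.
have h1 : t * p ^+ 2 <= p ^+ 2 by rewrite ler_piMl.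
have h2 : p ^+ 2 <= a * p ^+ 2 by rewrite ler_peMl.
have h3 : p ^+ 2 * p ^+ 2 <= p ^+ 2 by rewrite ler_piMl // expr_le1.
nra.
Qed.

(** Concavity: the right-hand side is the tangent at [v]. *)
Lemma sqrt_tangent (R : realType) (u v : R) : 0 <= u -> 0 < v ->
  Num.sqrt u <= Num.sqrt v - (v - u) / (2 * Num.sqrt v).
Proof.
move=> u0 v0; have b0 : 0 < Num.sqrt v by rewrite sqrtr_gt0.
rewrite -{2}(sqr_sqrtr u0) -{2}(sqr_sqrtr (ltW v0)).
move: (Num.sqrt u) (Num.sqrt v) b0 => a b b0.
have -> : b - (b ^+ 2 - a ^+ 2) / (2 * b) = (b ^+ 2 + a ^+ 2) / (2 * b).
  by field; lra.
have := sqr_ge0 (a - b); rewrite ler_pdivlMr ?mulr_gt0 // => ?; nra.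
Qed.

(** The derivative [k] of [chord_sum w] at its fixed point [r ^+ 2] is below 1, so the chord sum
    exceeds its argument slightly to the left. *)
Lemma kur_level1_locked (R : realType) n (r : R) (c s : 'I_n -> R)
    (w : 'rV[R]_n) :
  (1 < n)%N -> (forall i, c i ^+ 2 + s i ^+ 2 = 1) -> 0 < r -> \sum_i c i = r ->
  (forall i, 1 < r * c i) -> \sum_i s i ^+ 2 / c i < r ->
  (forall i, w 0 i = r * s i) -> kur_levels w 1.
Proof.
move=> n1 cs1 r0 cr rc Tr wE.
have c0 i : 0 < c i.
  by have := rc i; rewrite -(pmulr_rgt0 _ r0); apply: lt_trans.
pose k := \sum_i (2 * (r * c i))^-1.
have nR : (1 : R) < n%:R by rewrite ltr1n.
have k0 : 0 < k.
  rewrite /k (bigD1 (Ordinal n1)) //= ltr_wpDr ?sumr_ge0 // => [i _|].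
    by rewrite invr_ge0 ltW // !mulr_gt0.
  by rewrite invr_gt0 !mulr_gt0.
have k1 : k < 1.
  (* As [1 / c i = c i + s i ^+ 2 / c i], the bound [k < 1] is [Tr] restated. *)
  have -> : k = (r + \sum_i s i ^+ 2 / c i) / (2 * r).
    rewrite -{1}cr -big_split /= mulr_suml; apply: eq_bigr => i _.
    have -> : c i + s i ^+ 2 / c i = (c i)^-1.
      by rewrite -[X in _ = X]mul1r -(cs1 i); field; rewrite gt_eqF.
    by field; rewrite !gt_eqF.
  by rewrite ltr_pdivrMr; lra.
(* With this [d] the remainders [n * d ^+ 2 / 2] use up only half of the gain [d * (1 - k)]. *)
pose d := (1 - k) / n%:R.
have d0 : 0 < d by rewrite divr_gt0; lra.
have d1 : d <= 1 by rewrite ler_pdivrMr; lra.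
have dn : d * n%:R = 1 - k by rewrite divfK // gt_eqF; lra.
have r2 : n%:R <= r ^+ 2.
  rewrite expr2 -{2}cr mulr_sumr -[n in n%:R]card_ord -sumr_const.
  by apply: ler_sum => i _; apply: ltW.
exists (Num.sqrt (r ^+ 2 - d)); rewrite sqr_sqrtr; last lra.
split; first by rewrite sqrtr_gt0; lra.
  move=> i; rewrite -sqrtr_sqr ler_wsqrtr // wE exprMn.
  have := cs1 i; have := rc i; nra.
rewrite mul1r /chord_sum.
have lb : \sum_i (r * c i - d / (2 * (r * c i)) - d ^+ 2 / 2) <=
    \sum_i Num.sqrt (r ^+ 2 - d - w 0 i ^+ 2).
  apply: ler_sum => i _.
  have -> : r ^+ 2 - d - w 0 i ^+ 2 = (r * c i) ^+ 2 - d.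
    by rewrite wE; have := cs1 i; nra.
  by apply: sqrt_sub_ge; [exact: ltW|rewrite (ltW d0) d1].
apply: lt_le_trans lb; rewrite !sumrB -!mulr_sumr cr -/k sumr_const card_ord.
rewrite -mulr_natr; nra.
Qed.

(** The intermediate value theorem yields a fixed point [v] of [chord_sum w] to the right of
    [r1 ^+ 2]; concavity makes the slope there less than 1. *)
Lemma kur_level1_lockable (R : realType) n (w : 'rV[R]_n) :
  kur_levels w 1 ->
  exists (r : R) (c : 'I_n -> R),
    [/\ 0 < r, forall i, 0 < c i, forall i, c i ^+ 2 + (w 0 i / r) ^+ 2 = 1,
        \sum_i c i = r & \sum_i (w 0 i / r) ^+ 2 / c i < r].
Proof.
move=> [r1 [r10 wr1 r1S]]; rewrite mul1r in r1S.
pose h u := chord_sum w u - u.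
have hc : continuous h.
  move=> u; apply: continuousB; last exact: cvg_id.
  rewrite /chord_sum (_ : (fun _ => _) =
      \sum_(i < n) (fun u => Num.sqrt (u - w 0 i ^+ 2))); last first.
    by apply/funext => x; rewrite fct_sumE.
  apply: (big_ind (fun f : R -> R => {for u, continuous f})) => [|f g ? ?|i _].
  - exact: cvg_cst.
  - exact: continuousD.
  apply: continuous_comp; last exact: sqrt_continuous.
  by apply: continuousB; [exact: cvg_id|exact: cvg_cst].
have w2 i : w 0 i ^+ 2 <= r1 ^+ 2.
  by rewrite -(real_normK (num_real (w 0 i))) lerXn2r ?nnegrE // ltW.
(* Makes [h] nonpositive at [n ^ 2], the right end of the interval. *)
have Sle u : 0 <= u -> chord_sum w (u ^+ 2) <= n%:R * u.
  move=> u0; rewrite -[n in n%:R]card_ord mulr_natl -sumr_const.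
  apply: ler_sum => i _.
  rewrite -[leRHS](ger0_norm u0) -sqrtr_sqr ler_wsqrtr //.
  by rewrite gerBl sqr_ge0.
have r1n : r1 < n%:R.
  by have := lt_le_trans r1S (Sle _ (ltW r10)); nra.
have r1n2 : r1 ^+ 2 <= n%:R ^+ 2 by nra.
have [v v12 hv] : exists2 v, v \in `[r1 ^+ 2, n%:R ^+ 2] & h v = 0.
  apply: IVT => //; first exact: continuous_subspaceT.
  have hn : h (n%:R ^+ 2) <= 0.
    by rewrite subr_le0 (le_trans (Sle _ _)) ?expr2.
  have h1 : 0 < h (r1 ^+ 2) by rewrite subr_gt0.
  by rewrite ge_min hn orbT le_max ltW.
have v1 : r1 ^+ 2 < v.
  move: v12; rewrite in_itv /= => /andP[+ _].
  rewrite le_eqVlt => /orP[/eqP vE|//].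
  by move: hv; rewrite -vE /h => /eqP; rewrite subr_eq0 gt_eqF.
have v0 : 0 < v by apply: lt_trans v1; rewrite exprn_gt0.
have wv i : 0 < v - w 0 i ^+ 2 by rewrite subr_gt0; apply: le_lt_trans v1.
pose r := Num.sqrt v; have r0 : 0 < r by rewrite sqrtr_gt0.
have rv : r ^+ 2 = v by rewrite sqr_sqrtr // ltW.
pose c i := Num.sqrt (v - w 0 i ^+ 2) / r.
have c0 i : 0 < c i by rewrite divr_gt0 // sqrtr_gt0.
have cs1 i : c i ^+ 2 + (w 0 i / r) ^+ 2 = 1.
  rewrite /c !exprMn sqr_sqrtr; last exact: ltW.
  by rewrite -mulrDl subrK -rv -exprMn divff ?expr1n // gt_eqF.
have Sv : chord_sum w v = v by apply/eqP; rewrite -subr_eq0; apply/eqP.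
have cr : \sum_i c i = r.
  by rewrite -mulr_suml -/(chord_sum w v) Sv -rv expr2 mulfK // gt_eqF.
exists r, c; split => //.
(* This is the slope of [chord_sum w] at [v]; since [s^2 / c = 1 / c - c], the stability bound
   becomes [k < 1]. *)
pose k := \sum_i (2 * Num.sqrt (v - w 0 i ^+ 2))^-1.
have kE : \sum_i (w 0 i / r) ^+ 2 / c i = 2 * r * k - r.
  rewrite -[X in _ - X]cr mulr_sumr -sumrB; apply: eq_bigr => i _.
  have -> : (2 * Num.sqrt (v - w 0 i ^+ 2))^-1 = (2 * (r * c i))^-1.
    by rewrite /c (mulrC r) divfK // gt_eqF.
  rewrite -{1}[X in X / c i](addrK (c i ^+ 2)) (addrC _ (c i ^+ 2)) cs1.
  by field; rewrite !gt_eqF.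
rewrite kE; suff : k < 1 by nra.
(* The tangents at [v] bound the chord sum at [r1 ^+ 2], which exceeds [r1 ^+ 2]; hence
   [0 < (v - r1 ^+ 2) * (1 - k)]. *)
have : chord_sum w (r1 ^+ 2) <= v - (v - r1 ^+ 2) * k.
  rewrite -{1}Sv mulr_sumr -sumrB; apply: ler_sum => i _.
  apply: le_trans (sqrt_tangent _ (wv i)) _; first by rewrite subr_ge0.
  by rewrite opprB addrA subrK.
move=> Sk; rewrite -subr_gt0 -(pmulr_rgt0 _ (_ : 0 < v - r1 ^+ 2)) ?subr_gt0 //.
lra.
Qed.

(** * The Kuramoto norm *)

Lemma chord_sum_ge0 (R : realType) n (w : 'rV[R]_n) u : 0 <= chord_sum w u.
Proof. by apply: sumr_ge0 => i _; exact: sqrtr_ge0. Qed.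

Lemma kur_level_gt0 (R : realType) n (w : 'rV[R]_n) q : kur_levels w q -> 0 < q.
Proof.
move=> [r [r0 _ rq]].
rewrite ltNge; apply/negP => q0.
have := lt_trans (exprn_gt0 2 r0) rq.
by rewrite ltNge mulr_le0_ge0 ?chord_sum_ge0.
Qed.

Lemma kur_level_ex (R : realType) n (w : 'rV[R]_n) : (0 < n)%N ->
  exists q, kur_levels w q.
Proof.
move=> n0; pose r := \sum_i `|w 0 i| + 1.
have wr i : `|w 0 i| < r.
  by rewrite ltr_pwDr // (bigD1 i) //= lerDl sumr_ge0.
have r0 : 0 < r by rewrite ltr_wpDl // sumr_ge0.
have S0 : 0 < chord_sum w (r ^+ 2).
  rewrite /chord_sum (bigD1 (Ordinal n0)) //= ltr_pwDl ?sumr_ge0 //.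
    rewrite sqrtr_gt0 subr_gt0 -(real_normK (num_real (w 0 _))).
    by rewrite ltrXn2r ?nnegrE // ltW.
exists (r ^+ 2 / chord_sum w (r ^+ 2) + 1), r; split => // [i|].
  exact: ltW.
by rewrite mulrDl divfK ?gt_eqF // mul1r ltrDl.
Qed.

(** Serves the scalar 0 in homogeneity. For [w = 0] the chord sum at [r ^+ 2] is [n * r], so [r = q]
    works as [1 < n]. *)
Lemma kur_levels0 (R : realType) n (q : R) : (1 < n)%N -> 0 < q ->
  kur_levels (0 : 'rV[R]_n) q.
Proof.
move=> n1 q0; exists q; split => // [i|]; first by rewrite mxE normr0 ltW.
rewrite /chord_sum; under eq_bigr => i _ do
  rewrite mxE expr0n subr0 sqrtr_sqr ger0_norm ?(ltW q0) //.
rewrite sumr_const card_ord expr2 ltr_pM2l // -mulr_natr.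
by rewrite ltr_pMr // ltr1n.
Qed.

(** Reverse triangle inequality for the Lorentz form [r^2 - a^2]; squaring reduces it to
    [b * b' <= r * r' - a * a']. *)
Lemma chord_superadditive (R : realType) (r r' a a' : R) :
  `|a| <= r -> `|a'| <= r' ->
  Num.sqrt (r ^+ 2 - a ^+ 2) + Num.sqrt (r' ^+ 2 - a' ^+ 2) <=
  Num.sqrt ((r + r') ^+ 2 - (a + a') ^+ 2).
Proof.
move=> ar ar'.
have r0 : 0 <= r by apply: le_trans ar.
have r'0 : 0 <= r' by apply: le_trans ar'.
have sq (x y : R) : `|x| <= y -> 0 <= y ^+ 2 - x ^+ 2.
  by rewrite ler_norml => /andP[? ?]; nra.
have := sqr_sqrtr (sq _ _ ar); have := sqr_sqrtr (sq _ _ ar').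
have := sqrtr_ge0 (r ^+ 2 - a ^+ 2); have := sqrtr_ge0 (r' ^+ 2 - a' ^+ 2).
move: (Num.sqrt (r ^+ 2 - a ^+ 2)) (Num.sqrt (r' ^+ 2 - a' ^+ 2)).
move=> b b' b'0 b0 bE' bE.
have aa' : a * a' <= r * r'.
  by rewrite (le_trans (ler_norm _)) // normrM ler_pM.
have bb : b * b' <= r * r' - a * a'.
  rewrite -(@ler_pXn2r _ 2) ?nnegrE ?mulr_ge0 ?subr_ge0 // exprMn bE bE'.
  by have := sqr_ge0 (r * a' - r' * a); nra.
rewrite -[leLHS]ger0_norm ?addr_ge0 // -sqrtr_sqr ler_wsqrtr //; nra.
Qed.

Lemma kur_levelsD (R : realType) n (w w' : 'rV[R]_n) q q' :
  kur_levels w q -> kur_levels w' q' -> kur_levels (w + w') (q + q').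
Proof.
move=> wq wq'; have q0 := kur_level_gt0 wq; have q'0 := kur_level_gt0 wq'.
case: wq => r [r0 wr rq]; case: wq' => r' [r'0 wr' rq'].
exists (r + r'); split; first exact: addr_gt0.
  by move=> i; rewrite mxE (le_trans (ler_normD _ _)) // lerD.
have SD : chord_sum w (r ^+ 2) + chord_sum w' (r' ^+ 2) <=
    chord_sum (w + w') ((r + r') ^+ 2).
  rewrite -big_split /=; apply: ler_sum => i _.
  by rewrite mxE chord_superadditive.
apply: lt_le_trans (ler_wpM2l (ltW (addr_gt0 q0 q'0)) SD).
move: (chord_sum_ge0 w (r ^+ 2)) (chord_sum_ge0 w' (r' ^+ 2)) rq rq'.
move: (chord_sum w _) (chord_sum w' _) => S S' S00 S'00 rq rq'.
(* The cross term of [(r + r')^2], by the arithmetic-geometric mean: [(q S' + q' S)^2 >= 4 (q S) (q'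
   S') >= 4 (r r')^2]. *)
have : 2 * (r * r') <= q * S' + q' * S.
  have qS' : 0 <= q * S' by rewrite mulr_ge0 // ltW.
  have q'S : 0 <= q' * S by rewrite mulr_ge0 // ltW.
  have rr' : 0 <= 2 * (r * r') by rewrite !mulr_ge0 // ltW.
  rewrite -(@ler_pXn2r _ 2) ?nnegrE ?addr_ge0 //.
  have := ler_pM (sqr_ge0 r) (sqr_ge0 r') (ltW rq) (ltW rq').
  have := sqr_ge0 (q * S' - q' * S).
  nra.
nra.
Qed.

Lemma kur_levelsZ (R : realType) n (w : 'rV[R]_n) (a q : R) : a != 0 ->
  kur_levels w q -> kur_levels (a *: w) (`|a| * q).
Proof.
move=> a0 [r [r0 wr rq]]; have a'0 : 0 < `|a| by rewrite normr_gt0.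
exists (`|a| * r); split; first exact: mulr_gt0.
  by move=> i; rewrite mxE normrM ler_pM2l.
have -> : chord_sum (a *: w) ((`|a| * r) ^+ 2) = `|a| * chord_sum w (r ^+ 2).
  rewrite mulr_sumr; apply: eq_bigr => i _; rewrite mxE !exprMn.
  by rewrite real_normK ?num_real // -mulrBr sqrtrM ?sqr_ge0 // sqrtr_sqr.
by rewrite mulrACA exprMn -expr2 ltr_pM2l // exprn_gt0.
Qed.

Definition kur_norm (R : realType) n (w : 'rV[R]_n) : R := inf (kur_levels w).

Section KurNorm.
Context (R : realType) (n : nat) (n1 : (1 < n)%N).
Implicit Types w : 'rV[R]_n.

Lemma kur_levels_lb w : lbound (kur_levels w) 0.
Proof. by move=> q /kur_level_gt0/ltW. Qed.

Lemma kur_norm_le w q : kur_levels w q -> kur_norm w <= q.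
Proof. by apply: ge_inf; exists 0; exact: kur_levels_lb. Qed.

Lemma le_kur_norm w x : (forall q, kur_levels w q -> x <= q) -> x <= kur_norm w.
Proof. by move=> h; apply: lb_le_inf => //; exact/kur_level_ex/ltnW. Qed.

Lemma kur_norm_ge0 w : 0 <= kur_norm w.
Proof. by apply: le_kur_norm => q /kur_level_gt0/ltW. Qed.

Lemma kur_normD w w' : kur_norm (w + w') <= kur_norm w + kur_norm w'.
Proof.
rewrite -lerBlDr; apply: le_kur_norm => q wq.
rewrite lerBlDr -lerBlDl; apply: le_kur_norm => q' wq'.
by rewrite lerBlDl; apply/kur_norm_le/kur_levelsD.
Qed.

Lemma kur_normZ a w : kur_norm (a *: w) = `|a| * kur_norm w.
Proof.
(* The opposite inequality is this one for [a^-1] and [a *: w]. *)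
have leZ (b : R) (v : 'rV[R]_n) :
    b != 0 -> kur_norm (b *: v) <= `|b| * kur_norm v.
  move=> b0; rewrite -ler_pdivrMl ?normr_gt0 //; apply: le_kur_norm => q vq.
  by rewrite ler_pdivrMl ?normr_gt0 //; apply/kur_norm_le/kur_levelsZ.
have [->|a0] := eqVneq a 0; last first.
  apply/eqP; rewrite eq_le leZ //= -ler_pdivlMl ?normr_gt0 // -normfV.
  by rewrite -{1}[w](scalerK a0) leZ ?invr_eq0.
rewrite scale0r normr0 mul0r; apply/eqP; rewrite eq_le kur_norm_ge0 andbT.
by apply/ler_addgt0Pl => e e0; rewrite addr0; apply/kur_norm_le/kur_levels0.
Qed.

(** Levels are upward closed, and their defining inequality is strict: if 1 is a level, so is the
    midpoint of [r^2 / S] and 1. *)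
Lemma kur_norm_lt1 w : kur_norm w < 1 <-> kur_levels w 1.
Proof.
split=> [w1|[r [r0 wr rS]]]; last rewrite mul1r in rS.
  have [q [r [r0 wr rq]] q1] : exists2 q, kur_levels w q & q < 1.
    by apply: inf_lt => //; exact/kur_level_ex/ltnW.
  exists r; split => //; apply: lt_le_trans rq _.
  by rewrite ler_wpM2r ?chord_sum_ge0 // ltW.
have S0 : 0 < chord_sum w (r ^+ 2) by apply: lt_trans rS; rewrite exprn_gt0.
have q1 : r ^+ 2 / chord_sum w (r ^+ 2) < 1 by rewrite ltr_pdivrMr // mul1r.
apply: le_lt_trans (midf_lt q1).2; apply: kur_norm_le; exists r; split => //.
by rewrite -ltr_pdivrMr // (midf_lt q1).
Qed.

End KurNorm.


(** * Stable fixed points *)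

(** [c] and [s] are the cosines and sines of the phases in a rotated frame where the unit vectors
    sum to [(r, 0)]; there the coupling term is [- r * s i]. *)
Lemma stable_fixed_pointP (R : realType) n (omega theta : 'rV[R]_n)
    (r : R) (c s : 'I_n -> R) : (1 < n)%N ->
  (forall i j, cos (theta 0 j - theta 0 i) = c j * c i + s j * s i) ->
  (forall i j, sin (theta 0 j - theta 0 i) = s j * c i - c j * s i) ->
  \sum_i c i = r -> \sum_i s i = 0 ->
  stable_fixed_point (kuramoto omega) theta <->
  (forall i, omega 0 i = r * s i) /\
  (forall x : 'rV[R]_n, ~~ (x <= (const_mx 1 : 'rV[R]_n))%MS ->
     (x *m locked_mx r c s *m x^T) 0 0 < 0).
Proof.
move=> n1 cosE sinE cr s0.
have jE : jacobian (kuramoto omega) theta = locked_mx r c s.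
  rewrite jacobian_kuramoto; apply/matrixP => i j; rewrite !mxE cosE.
  congr (_ - _ *+ _); under eq_bigr => k _ do rewrite cosE.
  by rewrite big_split /= -!mulr_suml cr s0 mul0r addr0.
have sym : (locked_mx r c s)^T = locked_mx r c s.
  apply/matrixP => i j; rewrite !mxE eq_sym (mulrC (c j)) (mulrC (s j)).
  by case: eqP => [->|].
have u0 : (const_mx 1 : 'rV[R]_n) != 0.
  by apply/eqP => /rowP/(_ (Ordinal n1))/eqP; rewrite !mxE oner_eq0.
have uK : (const_mx 1 : 'rV[R]_n) *m locked_mx r c s = 0.
  apply/rowP => j; rewrite !mxE; under eq_bigr => i _ do rewrite !mxE mul1r.
  rewrite sumrB big_split /= -!mulr_suml cr s0 mul0r addr0.
  by rewrite (bigD1 j) //= eqxx big1 ?addr0 ?subrr // => i /negPf ->.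
have fE : kuramoto omega theta = 0 <-> forall i, omega 0 i = r * s i.
  have fi i : kuramoto omega theta 0 i = omega 0 i - r * s i.
    rewrite mxE; congr (_ + _); under eq_bigr => j _ do rewrite sinE.
    by rewrite sumrB -!mulr_suml cr s0 mul0r sub0r.
  split=> [/rowP e i|e]; first by have := e i; rewrite fi mxE => /subr0_eq.
  by apply/rowP => i; rewrite fi e subrr mxE.
have lin := symmetric_char_poly_simple_kernel sym u0 uK.
rewrite /stable_fixed_point jE; split=> [[/fE ? _ /lin ?] //|[/fE ? /lin ?]].
by split.
Qed.

(* [c] and [s] are the cosines and sines of the angles measured from the mean
   phase, the argument of [\sum_j expi (theta j)]. *)
Lemma mean_phase (R : realType) n (theta : 'rV[R]_n) :
  exists (r : R) (c s : 'I_n -> R),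
    [/\ 0 <= r, forall i, c i ^+ 2 + s i ^+ 2 = 1,
        \sum_i c i = r /\ \sum_i s i = 0,
        forall i j, cos (theta 0 j - theta 0 i) = c j * c i + s j * s i
      & forall i j, sin (theta 0 j - theta 0 i) = s j * c i - c j * s i].
Proof.
pose C := \sum_i cos (theta 0 i); pose S := \sum_i sin (theta 0 i).
pose r := Num.sqrt (C ^+ 2 + S ^+ 2).
have CS0 : 0 <= C ^+ 2 + S ^+ 2 by rewrite addr_ge0 ?sqr_ge0.
have rE : r ^+ 2 = C ^+ 2 + S ^+ 2 by rewrite sqr_sqrtr.
have [r0|r0] := eqVneq r 0.
  move/eqP: rE; rewrite r0 expr0n eq_sym paddr_eq0 ?sqr_ge0 // !sqrf_eq0.
  move=> /andP[/eqP C0 /eqP S0].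
  exists 0, (fun i => cos (theta 0 i)), (fun i => sin (theta 0 i)).
  split=> // [i|i j|i j]; first exact: cos2Dsin2.
    by rewrite cosB.
  by rewrite sinB.
(* Rotation by minus the mean phase, whose cosine and sine are [C / r] and [S / r]. *)
exists r, (fun i => (C * cos (theta 0 i) + S * sin (theta 0 i)) / r),
  (fun i => (C * sin (theta 0 i) - S * cos (theta 0 i)) / r).
have unit_r (x y : R) : r ^+ 2 * x = y -> y / r ^+ 2 = x.
  by move=> <-; rewrite mulrAC divff ?mul1r // expf_neq0.
split; first exact: sqrtr_ge0.
- move=> i; rewrite !expr_div_n -mulrDl; apply: unit_r.
  by rewrite rE -{1}(cos2Dsin2 (theta 0 i)); ring.
- rewrite -!mulr_suml big_split sumrB /= -!mulr_sumr -/C -/S; split.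
    by rewrite -!expr2 -rE expr2 mulfK.
  by rewrite (mulrC S) subrr mul0r.
- move=> i j; rewrite cosB; symmetry; rewrite !mulf_div -mulrDl -expr2.
  by apply: unit_r; rewrite rE; ring.
- move=> i j; rewrite sinB; symmetry; rewrite !mulf_div -mulrBl -expr2.
  by apply: unit_r; rewrite rE; ring.
Qed.

Lemma stable_fixed_pointE (R : realType) n (omega : 'rV[R]_n) : (1 < n)%N ->
  \sum_i omega 0 i = 0 ->
  (exists theta, stable_fixed_point (kuramoto omega) theta) <->
  kur_levels omega 1.
Proof.
move=> n1 om0.
split=> [[theta st]|/kur_level1_lockable[r [c [r0 c0 cs1 cr Tr]]]].
  have [r [c [s [r_ge0 cs1 [cr s0] cosE sinE]]]] := mean_phase theta.
  have [omE neg] := (stable_fixed_pointP omega n1 cosE sinE cr s0).1 st.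
  have [r0 rc Tr] := locked_form_lt0_inv n1 cs1 r_ge0 cr s0 neg.
  exact: kur_level1_locked omE.
have wr i : `|omega 0 i / r| <= 1.
  by rewrite -(@expr_le1 _ 2) // real_normK ?num_real // -(cs1 i) lerDr sqr_ge0.
have wr' i : -1 <= omega 0 i / r <= 1 by rewrite -ler_norml.
have sE i : sin (asin (omega 0 i / r)) = omega 0 i / r.
  by rewrite asinK // in_itv /=.
have cE i : cos (asin (omega 0 i / r)) = c i.
  rewrite cos_asin // -(cs1 i) addrK sqrtr_sqr ger0_norm //; exact: ltW.
(* The branch of [asin] has nonnegative cosine, hence cosine [c i] rather than [- c i]. *)
exists (\row_i asin (omega 0 i / r)).
have s0 : \sum_i omega 0 i / r = 0 by rewrite -mulr_suml om0 mul0r.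
apply/(@stable_fixed_pointP _ _ _ _ r c (fun i => omega 0 i / r)) => //.
- by move=> i j; rewrite !mxE cosB !sE !cE.
- by move=> i j; rewrite !mxE sinB !sE !cE.
split=> [i|x xc]; first by rewrite mulrCA divff ?mulr1 // gt_eqF.
exact: locked_form_lt0.
Qed.

Theorem mainTheorem1 (R : realType) (N : nat) (hN : (2 <= N)%N) :
  exists2 kur : subvs_of (zero_sum R N) -> R,
    is_seminorm kur & stable_region R N = [set omega | kur omega < 1].
Proof.
exists (fun omega => kur_norm (vsval omega)).
  split=> [x|a x|x y]; first exact: kur_norm_ge0.
    by rewrite linearZ kur_normZ.
  by rewrite linearD kur_normD.
have zs (omega : subvs_of (zero_sum R N)) : \sum_i vsval omega 0 i = 0.
  by apply/eqP; rewrite -mem_zero_sum subvsP.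
apply/seteqP; split=> omega /=.
  by move=> st; apply/(kur_norm_lt1 hN)/(stable_fixed_pointE hN (zs omega)).
by move=> /(kur_norm_lt1 hN)/(stable_fixed_pointE hN (zs omega)).
Qed.
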